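(* Let $M$ be an infinite subset of $\mathbb{N}$, $\mathcal{F}$ a hereditary family of finite subsets of $M$ and $\mathcal{L}$ a uniform family on $M$. Then for every infinite subset $M_1$ of $M$ there exists an infinite subset $L$ of $M_1$ such that either $\mathcal{L}_{*}\cap[L]^{<\omega}\subseteq\mathcal{F}$, or $\mathcal{F}\cap[L]^{<\omega}\subseteq\mathcal{L}^{*}\setminus\mathcal{L}$.
   Context: $\mathbb{N}=\{1,2,3,\dots\}$. For an infinite $M\subseteq\mathbb{N}$, $[M]^{<\omega}$ is the set of all finite subsets of $M$ and $[M]$ the set of all infinite subsets of $M$. For finite sets, $s<t$ means $\max s<\min t$ (vacuously true if one of them is empty). A family is hereditary if it contains every subset of each of its elements. For a family $\mathcal{L}$ of finite sets, $\mathcal{L}^{*}$ is the family of all initial segments (not necessarily proper, including $\emptyset$) of elements of $\mathcal{L}$, and $\mathcal{L}_{*}$ is the family of all subsets of elements of $\mathcal{L}$. Uniform families. Let $M\in[\mathbb{N}]$ and $\mathcal{L}\subseteq[M]^{<\omega}$. For $m\in M$ put $\mathcal{L}(m)=\{s\in[M]^{<\omega}:\{m\}\cup s\in\mathcal{L}\text{ and }\{m\}<s\}$. For countable ordinals $\xi$, ''$\mathcal{L}$ is $\xi$-uniform on $M$'' is defined recursively: (1) $\mathcal{L}$ is $0$-uniform on $M$ if $\mathcal{L}=\{\emptyset\}$; (2) if $\xi=\zeta+1$, $\mathcal{L}$ is $\xi$-uniform on $M$ if $\emptyset\notin\mathcal{L}$ and $\mathcal{L}(m)$ is $\zeta$-uniform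 on $M\cap(m,+\infty)$ for every $m\in M$; (3) if $\xi$ is a nonzero limit ordinal, $\mathcal{L}$ is $\xi$-uniform on $M$ if $\emptyset\notin\mathcal{L}$ and there is an increasing sequence $(\xi_m)_{m\in M}$ of ordinals smaller than $\xi$ with $\sup_m\xi_m=\xi$ such that $\mathcal{L}(m)$ is $\xi_m$-uniform on $M\cap(m,+\infty)$ for every $m\in M$. $\mathcal{L}$ is uniform on $M$ if it is $\xi$-uniform on $M$ for some countable ordinal $\xi$. *)

(* Defs.v *)
From mathcomp Require Import all_boot all_order finmap.
From mathcomp Require Import boolp classical_sets functions cardinality.

Set Implicit Arguments.
Unset Strict Implicit.
Unset Printing Implicit Defensive.

Local Open Scope classical_set_scope.

(* The natural numbers start at 1. *)
Definition posnats : set nat := [set n | (0 < n)%N].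

Definition fset_family := set {fset nat}.

Definition finsubsets (M : set nat) : fset_family :=
  [set s : {fset nat} | [set` s] `<=` M].

Definition hereditary (F : fset_family) : Prop :=
  forall s t : {fset nat}, F t -> (s `<=` t)%fset -> F s.

(* max s < min t, vacuously true when s or t is empty *)
Definition fset_before (s t : {fset nat}) : Prop :=
  forall x y, x \in s -> y \in t -> (x < y)%N.

Definition initial_segment (s t : {fset nat}) : Prop :=
  (s `<=` t)%fset /\
  forall x y, x \in s -> y \in t -> (y <= x)%N -> y \in s.

(* L^* *)
Definition initial_segments (L : fset_family) : fset_family :=
  [set s | exists2 t, L t & initial_segment s t].

(* L_* *)
Definition subsets (L : fset_family) : fset_family :=
  [set s | exists2 t, L t & (s `<=` t)%fset].

(* M `&` (m, +oo) *)
Definition above (M : set nat) (m : nat) : set nat :=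
  [set n | M n /\ (m < n)%N].

(* L(m), for L a family of finite subsets of M *)
Definition section (M : set nat) (L : fset_family) (m : nat) : fset_family :=
  [set s | [/\ finsubsets M s, L (m |` s)%fset & fset_before [fset m]%fset s]].

(* Ordinals are represented by the elements of a well-ordered type W: the
   element xi stands for the order type of [set eta | eta < xi]. The ordinals
   smaller than xi are then exactly the elements smaller than xi. *)
Section Ordinals.
Context {d : Order.disp_t} {W : orderType d}.
Implicit Types xi zeta : W.

Definition well_ordered : Prop := well_founded (fun x y : W => (x < y)%O).

Definition ord_zero xi : Prop := forall eta : W, (xi <= eta)%O.

(* xi = zeta + 1 *)
Definition ord_succ zeta xi : Prop :=
  (zeta < xi)%O /\ forall eta : W, (zeta < eta)%O -> (xi <= eta)%O.

Definition ord_limit xi : Prop :=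
  ~ ord_zero xi /\ forall zeta, ~ ord_succ zeta xi.

Definition ord_countable xi : Prop := countable [set eta : W | (eta < xi)%O].

(* "Increasing" is read in the weak sense in the limit case; this gives a class
   of families containing the one obtained from strictly increasing sequences. *)
Inductive ord_uniform : W -> set nat -> fset_family -> Prop :=
| Uniform0 xi (M : set nat) (L : fset_family) of
    ord_zero xi & L = [set fset0] :
    ord_uniform xi M L
| UniformS xi zeta (M : set nat) (L : fset_family) of
    ord_succ zeta xi & L `<=` finsubsets M & ~ L fset0 &
    (forall m, M m -> ord_uniform zeta (above M m) (section M L m)) :
    ord_uniform xi M L
| UniformLim xi (xi_ : nat -> W) (M : set nat) (L : fset_family) of
    ord_limit xi & L `<=` finsubsets M & ~ L fset0 &
    (forall m n, M m -> M n -> (m <= n)%N -> (xi_ m <= xi_ n)%O) &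
    (forall m, M m -> (xi_ m < xi)%O) &
    supremums [set xi_ m | m in M] xi &
    (forall m, M m -> ord_uniform (xi_ m) (above M m) (section M L m)) :
    ord_uniform xi M L.

End Ordinals.

Arguments well_ordered {d} W.

Definition uniform_on (M : set nat) (L : fset_family) : Prop :=
  exists (d : Order.disp_t) (W : orderType d) (xi : W),
    [/\ well_ordered W, ord_countable xi & ord_uniform xi M L].

(* Main.v *)
Require Import Defs.
From mathcomp Require Import all_boot all_order finmap.
From mathcomp Require Import boolp classical_sets functions cardinality.

Import Order.TTheory.

Local Open Scope classical_set_scope.

(** Write L[N] for the members of the uniform family L contained in N.

    The starting point is a Ramsey theorem (uniform_ramsey): inside M1 there is
    an infinite A with L[A] either contained in F or disjoint from F.

    If L[A] is disjoint from F, take N = A.  A uniform family is a front: a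
    finite subset s of A has an initial segment in L, or is a proper initial
    segment of a member of L (front_dichotomy).  For s in F the first case is
    excluded, as F is hereditary and that initial segment would lie in L[A].

    If L[A] is contained in F, then so are all subsets of members of L[A], but
    the subsets of members of L that happen to lie in N form a larger family: a
    subset s of N may be contained only in members of L that leave A.  It has to
    be shown that this cannot happen once N is thin enough
    (uniform_covers_self), and here the ranks matter.  Let s, with least element
    n, be contained in a member of L with least element m <= n.
    - If m = n, the rest of s is a subset of a member of the section L(n), and
      induction applies to L(n).
    - If m < n, then s is a subset of a member of L(m), whose rank is at most
      that of L(n).  The rest of s, which does not contain n, is then a subset
      of a member of a section L(m)(k) with k <= n, and the rank of L(m)(k) is
      strictly less than the rank of L(n).
    So everything is reduced to the comparison of two families of different
    ranks (uniform_dominates): if A has smaller rank than B, then on a thin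
    enough N every subset of a member of A is a subset of a member of B, the
    latter chosen inside a prescribed infinite set.  This is proved by induction
    on the rank of B with the same removal of the least element n: this time the
    rest of s is a subset of a member of A(k) with k <= n, and for large n the
    section B(n) has rank at least that of A, hence larger than that of A(k).

    In all these arguments only finitely many conditions are attached to each n
    (those given by the m and k below n), which is why a single infinite set can
    satisfy all of them, by diagonalization (fusion). *)

(** * Infinite sets of integers and fusion *)

Lemma infinite_natP (A : set nat) :
  infinite_set A <-> forall m, exists2 n, A n & (m < n)%N.
Proof.
split=> [Ainf m | Aunb Afin].
  have /(_ Ainf (finite_II m.+1)) := @infinite_setD _ A `I_m.+1.
  move=> /infinite_setN0[n /= [An /negP nm]].
  by exists n; rewrite // ltnNge -ltnS.
have /finite_fsetP[s As] := Afin.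
have [n An] := Aunb (\max_(i <- s) i).
by rewrite ltnNge (leq_bigmax_seq n) //; rewrite As in An.
Qed.

Lemma infinite_above {A : set nat} m :
  infinite_set A -> infinite_set (above A m).
Proof.
move=> /infinite_natP Aunb; apply/infinite_natP => k.
have [n An] := Aunb (maxn m k).
by rewrite gtn_max => /andP[mn kn]; exists n.
Qed.

Lemma aboveS {A B : set nat} m : A `<=` B -> above A m `<=` above B m.
Proof. by move=> AB n [/AB]. Qed.

Lemma above_sub (A : set nat) m : above A m `<=` A.
Proof. by move=> n []. Qed.

(** Density in the forcing order of infinite subsets of A: the properties that
    can be imposed on an infinite set by thinning it. *)
Definition densely (A : set nat) (Q : set nat -> Prop) : Prop :=
  forall B, infinite_set B -> B `<=` A ->
  exists N, [/\ infinite_set N, N `<=` B & Q N].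

Definition inherited (Q : set nat -> Prop) : Prop :=
  forall N N', N' `<=` N -> Q N -> Q N'.

Lemma densely_and {A Q1 Q2} : inherited Q1 ->
  densely A Q1 -> densely A Q2 -> densely A (fun N => Q1 N /\ Q2 N).
Proof.
move=> iQ1 dQ1 dQ2 B Binf BA.
have [N1 [N1inf N1B Q1N]] := dQ1 B Binf BA.
have [N2 [N2inf N2N1 Q2N]] := dQ2 N1 N1inf (subset_trans N1B BA).
by exists N2; split; [| exact: subset_trans N1B | split => //; exact: iQ1 Q1N].
Qed.

Lemma densely_forall_lt {A} {Q : nat -> set nat -> Prop} k :
  (forall i, (i < k)%N -> inherited (Q i)) ->
  (forall i, (i < k)%N -> densely A (Q i)) ->
  densely A (fun N => forall i, (i < k)%N -> Q i N).
Proof.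
elim: k => [|k IH] iQ dQ B Binf BA; first by exists B; split.
have iQ' : inherited (Q k) by exact: iQ.
have dQ' := IH (fun i ik => iQ i (ltnW ik)) (fun i ik => dQ i (ltnW ik)).
have [N [Ninf NB [QkN QN]]] :=
  densely_and iQ' (dQ k (ltnSn k)) dQ' B Binf BA.
exists N; split=> // i; rewrite ltnS leq_eqVlt => /orP[/eqP -> //|]; exact: QN.
Qed.

(** The set N is enumerated as x 0 < x 1 < ..., together with a decreasing
    sequence of infinite sets B k: x k is taken in B k, and then B k.+1 is
    chosen above x k with P (x k) (B k.+1).  As the part of N above x k is
    contained in B k.+1, it inherits the property. *)
Lemma fusion (P : nat -> set nat -> Prop) (A : set nat) :
  infinite_set A -> (forall n, A n -> inherited (P n)) ->
  (forall n, A n -> densely (above A n) (P n)) ->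
  exists N, [/\ infinite_set N, N `<=` A & forall n, N n -> P n (above N n)].
Proof.
move=> Ainf iP dP.
have step (B : set nat) : exists p : nat * set nat, infinite_set B -> B `<=` A ->
    [/\ B p.1, infinite_set p.2, p.2 `<=` above B p.1 & P p.1 p.2].
  have [[Binf BA]|nB] := pselect (infinite_set B /\ B `<=` A); last first.
    by exists (0%N, B) => Binf BA; case: nB.
  have [n Bn] := infinite_setN0 Binf.
  have [C [Cinf CB PC]] :=
    dP n (BA n Bn) _ (infinite_above n Binf) (aboveS n BA).
  by exists (n, C).
have [f fP] := choice step.
(* f chooses, from an infinite set B, the next point and the next set. *)
pose B k := iter k (fun C => (f C).2) A.
pose x k := (f (B k)).1.
have BP k : infinite_set (B k) /\ B k `<=` A.
  elim: k => [|k [Binf BA]]; first by split.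
  have [_ Cinf CB _] := fP _ Binf BA.
  by split=> //; apply: subset_trans CB (subset_trans (@above_sub _ _) BA).
have xB k : B k (x k) by have [Binf BA] := BP k; case: (fP _ Binf BA).
have BS k : B k.+1 `<=` above (B k) (x k).
  by have [Binf BA] := BP k; case: (fP _ Binf BA).
have BPx k : P (x k) (B k.+1).
  by have [Binf BA] := BP k; case: (fP _ Binf BA).
have Bmono j k : (j <= k)%N -> B k `<=` B j.
  move=> /subnKC <-; elim: (k - j)%N => [|i IH]; first by rewrite addn0.
  by rewrite addnS; apply: subset_trans (BS _) (subset_trans (@above_sub _ _) IH).
have xlt j k : (j < k)%N -> (x j < x k)%N.
  by move=> jk; case: (BS j _ (Bmono _ _ jk _ (xB k))).
exists (range x); split.
- apply/infinite_natP => m; exists (x m.+1); first by exists m.+1.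
  elim: m => [|m IH]; first exact: leq_trans (xlt 0%N 1%N _).
  exact: leq_ltn_trans IH (xlt _ _ _).
- by move=> _ [k _ <-]; case: (BP k) => _; apply.
- move=> _ [k _ <-]; apply: iP (BPx k); first by case: (BP k) => _; apply.
  move=> _ [[j _ <-]]; case: (ltnP k j) => [kj _|].
    exact: Bmono kj _ (xB j).
  rewrite leq_eqVlt => /orP[/eqP -> |/xlt jk]; first by rewrite ltnn.
  by rewrite ltnNge ltnW.
Qed.

(** * Finite sets and sections *)

Lemma fset_beforeP n (s : {fset nat}) :
  fset_before [fset n]%fset s <-> forall y, y \in s -> (n < y)%N.
Proof.
split=> ns => [y|x y]; first by apply: ns; rewrite inE.
by rewrite inE => /eqP ->; exact: ns.
Qed.

Lemma fset_min_decomp {s : {fset nat}} : s <> fset0 ->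
  exists n s', s = (n |` s')%fset /\ fset_before [fset n]%fset s'.
Proof.
move=> /eqP/fset0Pn exs; have [n ns nmin] := ex_minnP exs.
exists n, (s `\ n)%fset; split; first by rewrite fsetD1K.
apply/fset_beforeP => y; rewrite !inE => /andP[yn ys].
by rewrite ltn_neqAle eq_sym yn nmin.
Qed.

Lemma finsubsetsU1 {A : set nat} {n s} :
  finsubsets A (n |` s)%fset <-> A n /\ finsubsets A s.
Proof.
split=> [As | [An As] y].
  by split=> [|y ys]; apply: As => /=; rewrite !inE ?eqxx // ys orbT.
by rewrite /= in_fset1U => /orP[/eqP -> //|]; exact: As.
Qed.

Lemma finsubsets_above {A : set nat} {n s} :
  finsubsets (above A n) s <-> finsubsets A s /\ fset_before [fset n]%fset s.
Proof.
split=> [As | [As /fset_beforeP ns] y ys]; last by split; [exact: As|exact: ns].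
split; last by apply/fset_beforeP => y /As[].
by move=> y /As[].
Qed.

Lemma finsubsetsS {A B : set nat} : A `<=` B -> finsubsets A `<=` finsubsets B.
Proof. by move=> AB s sA y /sA/AB. Qed.

Lemma fsubset_before n (s t : {fset nat}) :
  (s `<=` t)%fset -> fset_before [fset n]%fset t -> fset_before [fset n]%fset s.
Proof. by move=> /fsubsetP st nt x y xn /st; exact: nt. Qed.

Lemma fsubset_removeU1 m (s t : {fset nat}) :
  m \notin s -> (s `<=` m |` t)%fset -> (s `<=` t)%fset.
Proof.
move=> ms /fsubsetP st; apply/fsubsetP => x xs.
move: (st x xs); rewrite in_fset1U => /orP[/eqP xm|//].
by rewrite xm (negbTE ms) in xs.
Qed.

Lemma section_decomp {M L t} : L `<=` finsubsets M -> ~ L fset0 -> L t ->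
  exists m t', [/\ M m, section M L m t' & t = (m |` t')%fset].
Proof.
move=> LM L0 Lt; have t0 : t <> fset0 by move=> t0; rewrite -t0 in L0.
have [m [t' [tE mt']]] := fset_min_decomp t0.
have /finsubsetsU1[Mm Mt'] : finsubsets M (m |` t')%fset by rewrite -tE; exact: LM.
by exists m, t'; split=> //; split=> //; rewrite -tE.
Qed.

(** * Ranks of sections *)

Section Ranks.
Context {d : Order.disp_t} {W : orderType d}.
Implicit Types zeta : W.

(** What the successor and limit clauses have in common, so that the two kinds of
    ordinals can be treated together. *)
Definition section_ranks (xi : W) (M : set nat) (xi_ : nat -> W) : Prop :=
  [/\ forall m, M m -> (xi_ m < xi)%O,
      forall m n, M m -> M n -> (m <= n)%N -> (xi_ m <= xi_ n)%O &
      forall zeta, (zeta < xi)%O ->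
        exists n0, forall n, M n -> (n0 <= n)%N -> (zeta <= xi_ n)%O].

Lemma succ_section_ranks zeta xi M :
  ord_succ zeta xi -> section_ranks xi M (fun=> zeta).
Proof.
move=> [zx xmin]; split=> // eta ex; exists 0%N => n _ _.
by rewrite leNgt; apply/negP => /xmin; rewrite leNgt ex.
Qed.

Lemma limit_section_ranks xi M xi_ :
  (forall m n, M m -> M n -> (m <= n)%N -> (xi_ m <= xi_ n)%O) ->
  (forall m, M m -> (xi_ m < xi)%O) ->
  supremums [set xi_ m | m in M] xi -> section_ranks xi M xi_.
Proof.
move=> xmono xlt [_ xsup]; split=> // zeta zx.
have [m Mm zm] : exists2 m, M m & (zeta <= xi_ m)%O.
  apply: contrapT => nex.
  have /xsup : ubound [set xi_ m | m in M] zeta.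
    move=> _ [m Mm <-]; rewrite leNgt; apply/negP => /ltW zm.
    by apply: nex; exists m.
  by rewrite leNgt zx.
by exists m => n Mn mn; apply: le_trans zm (xmono _ _ _ _ _).
Qed.

(** The recursive occurrences of ord_uniform are under a product, and the ranks
    are repackaged, hence the explicit fixpoint. *)
Lemma ord_uniform_section_ind (T : W -> set nat -> fset_family -> Prop) :
  (forall xi M, ord_zero xi -> T xi M [set fset0]) ->
  (forall xi xi_ M L, ord_uniform xi M L -> L `<=` finsubsets M -> ~ L fset0 ->
    section_ranks xi M xi_ ->
    (forall m, M m -> ord_uniform (xi_ m) (above M m) (section M L m)) ->
    (forall m, M m -> T (xi_ m) (above M m) (section M L m)) -> T xi M L) ->
  forall xi M L, ord_uniform xi M L -> T xi M L.
Proof.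
move=> T0 TS; fix IH 4 => xi M L [].
- by move=> {}xi {}M {}L xi0 ->; exact: T0.
- move=> {}xi zeta {}M {}L sxi LM L0 uL.
  apply: (TS _ (fun=> zeta)) => //; first exact: UniformS uL.
    exact: succ_section_ranks.
  by move=> m /uL; exact: IH.
- move=> {}xi xi_ {}M {}L lxi LM L0 xmono xlt xsup uL.
  apply: (TS _ xi_) => //; first exact: UniformLim xsup uL.
    exact: limit_section_ranks.
  by move=> m /uL; exact: IH.
Qed.

Lemma ord_uniform_cases {xi : W} {M L} : ord_uniform xi M L ->
  (ord_zero xi /\ L = [set fset0]) \/
  exists xi_, [/\ L `<=` finsubsets M, ~ L fset0, section_ranks xi M xi_ &
    forall m, M m -> ord_uniform (xi_ m) (above M m) (section M L m)].
Proof.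
move: xi M L; apply: ord_uniform_section_ind => [|xi xi_]; first by left.
by move=> M L _; right; exists xi_; split.
Qed.

(** * Uniform families as fronts *)

(** Removing the least element of s replaces L by a section, whose members all
    extend by that element to members of L; if s is empty and L has positive
    rank, any n in N serves to find a member of L contained in N. *)
Lemma front_dichotomy {xi : W} {M L} : ord_uniform xi M L ->
  forall N s, infinite_set N -> N `<=` M -> finsubsets N s ->
  (exists2 u, L u & initial_segment u s) \/
  (~ L s /\ exists u, [/\ L u, finsubsets N u & initial_segment s u]).
Proof.
move: xi M L; apply: ord_uniform_section_ind.
  by move=> _ M _ N s _ _ _; left; exists fset0.
move=> xi xi_ M L _ LM L0 _ _ IH N s Ninf NM Ns.
have [s0|s0] := EM (s = fset0).
  right; split; first by rewrite s0.
  have [n Nn] := infinite_setN0 Ninf.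
  have Nn' := aboveS n NM.
  have N0 : finsubsets (above N n) fset0 by move=> y; rewrite /= inE.
  have [u [[_ Lu _] Nu]] : exists u, section M L n u /\ finsubsets (above N n) u.
    case: (IH n (NM n Nn) _ fset0 (infinite_above n Ninf) Nn' N0).
      move=> [u Lu [+ _]]; rewrite fsubset0 => /eqP u0.
      by exists u; rewrite {2}u0.
    by move=> [_ [u [Lu Nu _]]]; exists u.
  exists (n |` u)%fset; split=> //.
    by apply/finsubsetsU1; split=> //; case/finsubsets_above: Nu.
  by rewrite s0; split=> [|x y]; rewrite ?fsub0set ?inE.
have [n [s' [sE ns']]] := fset_min_decomp s0.
have /finsubsetsU1[Nn Ns'] : finsubsets N (n |` s')%fset by rewrite -sE.
have initU1 u v : fset_before [fset n]%fset u -> fset_before [fset n]%fset v ->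
    initial_segment u v -> initial_segment (n |` u)%fset (n |` v)%fset.
  move=> /fset_beforeP nu /fset_beforeP nv [uv ui]; split; first exact: fsetUS.
  move=> x y; rewrite !in_fset1U; case: (eqVneq y n) => //= _.
  move=> /orP[/eqP -> /nv yn|]; first by rewrite leqNgt yn.
  exact: ui.
have Ns'' : finsubsets (above N n) s' by apply/finsubsets_above.
case: (IH n (NM n Nn) _ s' (infinite_above n Ninf) (aboveS n NM) Ns'').
  move=> [u [_ Lu nu] us]; left; exists (n |` u)%fset => //.
  by rewrite sE; exact: initU1.
move=> [nLs [u [[_ Lu nu] Nu su]]]; right; split.
  move=> Ls; apply: nLs; split=> //; last by rewrite -sE.
  exact: finsubsetsS Ns'.
exists (n |` u)%fset; split=> //; last by rewrite sE; exact: initU1.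
by apply/finsubsetsU1; split=> //; case/finsubsets_above: Nu.
Qed.

Lemma uniform_nonempty {xi : W} {M L N} : ord_uniform xi M L ->
  infinite_set N -> N `<=` M -> exists2 u, L u & finsubsets N u.
Proof.
move=> uL Ninf NM.
have N0 : finsubsets N fset0 by move=> y; rewrite /= inE.
case: (front_dichotomy uL _ _ Ninf NM N0).
  by move=> [u Lu [+ _]]; rewrite fsubset0 => /eqP u0; exists u; rewrite // u0.
by move=> [_ [u [Lu Nu _]]]; exists u.
Qed.

(** By induction, for each n the section L(n) can be made to lie inside or
    outside the trace of F; fusion does this for all n of an infinite set N.
    Each n in N then carries one of two colours, and a colour carried by
    infinitely many n gives the required set. *)
Lemma uniform_ramsey {xi : W} {M L} : ord_uniform xi M L ->
  forall (F : fset_family) A, infinite_set A -> A `<=` M ->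
  exists N, [/\ infinite_set N, N `<=` A &
    L `&` finsubsets N `<=` F \/ L `&` finsubsets N `<=` ~` F].
Proof.
move: xi M L; apply: ord_uniform_section_ind.
  move=> _ M _ F A Ainf AM; exists A; split=> //.
  by have [F0|F0] := EM (F fset0); [left|right] => s [-> _].
move=> xi xi_ M L _ LM L0 _ _ IH F A Ainf AM.
pose G n : fset_family := [set s | F (n |` s)%fset].
pose inF n N := section M L n `&` finsubsets N `<=` G n.
pose outF n N := section M L n `&` finsubsets N `<=` ~` G n.
have [N [Ninf NA Nmono]] :
    exists N, [/\ infinite_set N, N `<=` A &
                  forall n, N n -> inF n (above N n) \/ outF n (above N n)].
  apply: (fusion (fun n N => inF n N \/ outF n N)) => // n An.
    move=> N N' N'N [] h; [left|right] => s [Ls Ns]; apply: h; split=> //;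
    exact: finsubsetsS Ns.
  move=> B Binf BA.
  exact: (IH n (AM n An) (G n) B Binf (subset_trans BA (aboveS n AM))).
(* The points n of N whose section has the same behaviour with respect to
   a target H produce only members of L in H; H is F or its complement. *)
have lift (C : nat -> set nat -> Prop) (H : fset_family) :
    (forall n, C n = fun N => section M L n `&` finsubsets N `<=`
                              [set s | H (n |` s)%fset]) ->
    L `&` finsubsets (N `&` [set n | C n (above N n)]) `<=` H.
  move=> CE t [Lt Nt]; have [n [s [Mn Ls tE]]] := section_decomp LM L0 Lt.
  move: Nt; rewrite tE => /finsubsetsU1[[Nn /= Cn] Ns].
  rewrite CE in Cn; apply: (Cn s); split=> //; apply/finsubsets_above; split.
    by apply: finsubsetsS Ns => y [].
  by case: Ls.
have [Iinf|Ifin] := EM (infinite_set (N `&` [set n | inF n (above N n)])).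
  exists (N `&` [set n | inF n (above N n)]); split=> //; first by move=> y [/NA].
  by left; apply: (lift inF).
exists (N `&` [set n | outF n (above N n)]); split; first last.
- by right; apply: (lift outF).
- by move=> y [/NA].
move=> Ofin; apply: Ninf; apply: (@sub_finite_set _ _
  ((N `&` [set n | inF n (above N n)]) `|` (N `&` [set n | outF n (above N n)]))).
  by move=> n Nn; case: (Nmono n Nn); [left|right].
by rewrite finite_setU; split=> //; apply: contrapT.
Qed.

(** * Comparing uniform families by their ranks *)

(** The covering members of B are confined to A1 because the conclusion is wanted
    for members of L already known to lie in F, which are those inside an
    infinite set given by uniform_ramsey. *)
Definition covers (B : fset_family) (A1 : set nat) (A : fset_family) N : Prop :=
  subsets A `&` finsubsets N `<=` subsets (B `&` finsubsets A1).

(** The weaker relation that holds without a strict inequality of the ranks: the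
    subset n |` s is covered only after its least element n is removed. *)
Definition covers_tails (B : fset_family) (A1 : set nat) (A : fset_family) n N :
  Prop :=
  forall s, finsubsets N s -> fset_before [fset n]%fset s ->
    subsets A (n |` s)%fset -> subsets (B `&` finsubsets A1) s.

Lemma covers_inherited B A1 A : inherited (covers B A1 A).
Proof.
by move=> N N' N'N cov s [As Ns]; apply: cov; split=> //; exact: finsubsetsS Ns.
Qed.

Lemma covers_tails_inherited B A1 A n : inherited (covers_tails B A1 A n).
Proof. by move=> N N' N'N cov s Ns; apply: cov; exact: finsubsetsS Ns. Qed.

Lemma subsets_restrictS (B : fset_family) (A1 A2 : set nat) : A1 `<=` A2 ->
  subsets (B `&` finsubsets A1) `<=` subsets (B `&` finsubsets A2).
Proof.
move=> A12 s [t [Bt At] st]; exists t => //; split=> //; exact: finsubsetsS At.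
Qed.

Lemma subsets_sectionU1 M (B : fset_family) (A1 : set nat) n s : A1 n ->
  subsets (section M B n `&` finsubsets (above A1 n)) s ->
  subsets (B `&` finsubsets A1) (n |` s)%fset.
Proof.
move=> An [t [[_ Bt _] /finsubsets_above[At _]] st].
exists (n |` t)%fset; last exact: fsetUS.
by split=> //; apply/finsubsetsU1.
Qed.

(** The common reduction to sections at the least element n of the set to be
    covered; the empty set is covered because B has a member contained in A1. *)
Lemma covers_of_sections {xi : W} {M B A A1 N} : ord_uniform xi M B ->
  infinite_set A1 -> A1 `<=` M -> N `<=` A1 ->
  (forall n s, N n -> finsubsets (above N n) s -> subsets A (n |` s)%fset ->
     subsets (section M B n `&` finsubsets (above A1 n)) s) ->
  covers B A1 A N.
Proof.
move=> uB A1inf A1M NA1 cov s [As Ns].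
have [->|s0] := EM (s = fset0).
  by have [u Bu Au] := uniform_nonempty uB A1inf A1M; exists u; rewrite ?fsub0set.
have [n [s' [sE ns']]] := fset_min_decomp s0.
move: Ns As; rewrite sE => /finsubsetsU1[Nn Ns'] As.
apply: (@subsets_sectionU1 M); first exact: NA1.
by apply: cov => //; apply/finsubsets_above.
Qed.

Definition dominates zeta (MB : set nat) (B : fset_family) : Prop :=
  forall xi MA A A1, (xi < zeta)%O -> ord_uniform xi MA A ->
  A1 `<=` MB -> densely A1 (covers B A1 A).

(** Let n |` s be contained in t, a member of A.  The least element k of t is at
    most n, so it does not belong to s, and s is contained in t minus k, a member
    of A(k).  The rank of A(k) is strictly less than that of A, hence than zeta,
    so that B dominates A(k); and only the finitely many k <= n are involved. *)
Lemma dominates_tails {zeta MB B} : dominates zeta MB B ->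
  forall xi MA A A1 n, (xi <= zeta)%O -> ord_uniform xi MA A ->
  A1 `<=` MB -> densely A1 (covers_tails B A1 A n).
Proof.
move=> dom xi MA A A1 n xz uA A1M.
have [[_ AE]|[xi_ [AM A0 [xlt _ _] uAs]]] := ord_uniform_cases uA.
  move=> C Cinf CA; exists C; split=> // s _ _ [t].
  by rewrite AE => -> /fsubsetP/(_ n (fset1U1 _ _)); rewrite inE.
pose Q k N := MA k -> covers B A1 (section MA A k) N.
have dQ : densely A1 (fun N => forall k, (k < n.+1)%N -> Q k N).
  apply: densely_forall_lt => k _.
    by move=> N N' N'N cov Mk; exact: covers_inherited (cov Mk).
  have [Mk|Mk] := EM (MA k); last by move=> C; exists C; split.
  move=> C Cinf CA; have [N [Ninf NC NQ]] := dom (xi_ k) _ _ _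
    (lt_le_trans (xlt k Mk) xz) (uAs k Mk) A1M C Cinf CA.
  by exists N; split.
move=> C Cinf CA; have [N [Ninf NC QN]] := dQ C Cinf CA.
exists N; split=> // s Ns /fset_beforeP ns [t At nst].
have [k [t' [Mk At' tE]]] := section_decomp AM A0 At.
have /fset_beforeP kt' : fset_before [fset k]%fset t' by case: At'.
have kn : (k <= n)%N.
  have : n \in t by move/fsubsetP: nst; apply; exact: fset1U1.
  by rewrite tE in_fset1U => /orP[/eqP ->//|/kt'/ltnW].
apply: (QN k kn Mk); split=> //; exists t' => //.
apply: (@fsubset_removeU1 k); first by apply/negP => /ns; rewrite ltnNge kn.
by rewrite -tE; apply: fsubset_trans nst; exact: fsubsetU1.
Qed.

(** Well-founded induction on the rank of B.  For large n the section B(n) has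
    rank at least that of A, and dominates all families of smaller rank by
    induction; so dominates_tails applies to A and B(n), and covers what remains
    after the least element n is removed. *)
Lemma uniform_dominates {zeta MB B} :
  well_ordered W -> ord_uniform zeta MB B -> dominates zeta MB B.
Proof.
move=> wfW; elim: (wfW zeta) MB B => {}zeta _ IH MB B uB.
move=> xi MA A A1 xz uA A1M C Cinf CA.
have [[z0 _]|[zeta_ [BM B0 [zlt _ zcof] uBs]]] := ord_uniform_cases uB.
  by move: (z0 xi); rewrite leNgt xz.
have [n0 xn] := zcof xi xz.
have CM := subset_trans CA A1M.
pose P n := covers_tails (section MB B n) (above C n) A n.
have [|||N [Ninf NC PN]] := fusion P (above C n0).
- exact: infinite_above.
- by move=> n _; exact: covers_tails_inherited.
- move=> n [Cn n0n] D Dinf DC.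
  have Mn := CM n Cn.
  apply: (dominates_tails (IH _ (zlt n Mn) _ _ (uBs n Mn)) xi MA A _ n) => //.
  + exact/xn/ltnW.
  + exact: aboveS.
  + exact: subset_trans DC (aboveS n (@above_sub _ _)).
have NC' := subset_trans NC (@above_sub _ _).
exists N; split=> //.
suff cov : covers B C A N.
  by move=> s /cov; exact: subsets_restrictS.
apply: (covers_of_sections uB Cinf CM NC') => n s Nn Ns As.
by apply: PN => //; case/finsubsets_above: Ns.
Qed.

(** Equality of ranks would not suffice here, as two families of the same limit
    rank need not cover each other.  What helps is that the ranks of
    the sections of L are nondecreasing: if a subset with least element n is
    contained in a member of L with least element m < n, then L(m) has at most
    the rank of L(n), and dominates_tails applies to this pair.  If m = n the two
    sections coincide, and the induction hypothesis applies. *)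
Lemma uniform_covers_self {xi : W} {M L} :
  well_ordered W -> ord_uniform xi M L ->
  forall A, infinite_set A -> A `<=` M ->
  exists N, [/\ infinite_set N, N `<=` A & covers L A L N].
Proof.
move=> wfW; move: xi M L; apply: ord_uniform_section_ind.
  move=> xi M _ A Ainf AM; exists A; split=> // s [[t Lt st] _]; exists t => //.
  by split=> //; rewrite Lt => y; rewrite /= inE.
move=> xi xi_ M L uL LM L0 [_ xmono _] uLs IH A Ainf AM.
pose self n N := covers (section M L n) (above A n) (section M L n) N.
pose tails n m N := M m ->
  covers_tails (section M L n) (above A n) (section M L m) n N.
have tails_inh n m : inherited (tails n m).
  by move=> N N' N'N cov Mm; exact: covers_tails_inherited (cov Mm).
pose P n N := self n N /\ forall m, (m < n)%N -> tails n m N.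
have [n An|n An|N [Ninf NA PN]] := fusion P A Ainf.
- move=> N N' N'N [selfN tailsN]; split; first exact: covers_inherited selfN.
  by move=> m mn; exact: tails_inh (tailsN m mn).
- have Mn := AM n An.
  apply: densely_and.
  + exact: covers_inherited.
  + move=> B Binf BA.
    have [N [Ninf NB cov]] := IH n Mn B Binf (subset_trans BA (aboveS n AM)).
    by exists N; split=> // s /cov; exact: subsets_restrictS.
  + apply: densely_forall_lt => m mn; first exact: tails_inh.
    have [Mm|Mm] := EM (M m); last by move=> B; exists B; split.
    move=> B Binf BA.
    have [N [Ninf NB cov]] :=
      dominates_tails (uniform_dominates wfW (uLs n Mn)) _ _ _ _ n
        (xmono _ _ Mm Mn (ltnW mn)) (uLs m Mm) (aboveS n AM) B Binf BA.
    by exists N; split.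
exists N; split=> //; apply: (covers_of_sections uL Ainf AM NA).
move=> n s Nn Ns [t Lt nst].
have [selfN tailsN] := PN n Nn.
have [_ ns] := (finsubsets_above).1 Ns.
have [m [t' [Mm Lt' tE]]] := section_decomp LM L0 Lt.
have /fset_beforeP mt' : fset_before [fset m]%fset t' by case: Lt'.
have nsn : n \notin s by apply/negP => /((fset_beforeP _ _).1 ns); rewrite ltnn.
have : (m <= n)%N.
  have : n \in t by move/fsubsetP: nst; apply; exact: fset1U1.
  by rewrite tE in_fset1U => /orP[/eqP ->//|/mt'/ltnW].
rewrite leq_eqVlt => /orP[/eqP mn|mn].
  apply: selfN; split=> //; exists t'; first by rewrite -mn.
  apply: (@fsubset_removeU1 n) => //; rewrite -{1}mn -tE.
  by apply: fsubset_trans nst; exact: fsubsetU1.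
apply: (tailsN m mn Mm) => //; exists t' => //.
apply: (@fsubset_removeU1 m); last by rewrite -tE.
rewrite in_fset1U (ltn_eqF mn) /=.
by apply/negP => /((fset_beforeP _ _).1 ns); rewrite ltnNge ltnW.
Qed.

End Ranks.

Theorem theorem2p12 (M : set nat) (F L : fset_family) :
  M `<=` posnats -> infinite_set M ->
  F `<=` finsubsets M -> hereditary F ->
  uniform_on M L ->
  forall M1 : set nat, infinite_set M1 -> M1 `<=` M ->
  exists N : set nat,
    [/\ infinite_set N,
        N `<=` M1 &
        subsets L `&` finsubsets N `<=` F \/
        F `&` finsubsets N `<=` initial_segments L `\` L].
Proof.
move=> _ _ _ hF [d [W [xi [wfW _ uL]]]] M1 M1inf M1M.
have [A [Ainf AM1 [AF|AF]]] := uniform_ramsey uL F M1 M1inf M1M.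
  have [N [Ninf NA cov]] :=
    uniform_covers_self wfW uL A Ainf (subset_trans AM1 M1M).
  exists N; split; [by []|exact: subset_trans NA AM1|left].
  by move=> s /cov[t /AF Ft st]; exact: hF Ft st.
exists A; split=> //; right=> s [Fs As].
case: (front_dichotomy uL _ _ Ainf (subset_trans AM1 M1M) As).
  move=> [u Lu [us _]]; exfalso; apply: (AF u); last exact: hF Fs us.
  by split=> // y yu; apply: As; move/fsubsetP: us; apply.
by move=> [nLs [u [Lu _ su]]]; split=> //; exists u.
Qed.
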